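(* Let $K_1,K_2\subset\mathbb{R}^2$ be finite sets (of pixels), and let the underlying distance-function be the Euclidean distance $\delta(i,j,x,y)=\sqrt{(i-x)^2+(j-y)^2}$. Let $\{\alpha(i,j):(i,j)\in K_1\}$, $\{\beta(x,y):(x,y)\in K_2\}$ be a feasible set of dual variables such that each pixel in $K_1$ and each pixel in $K_2$ belongs to an admissible arc. Let $(i_0,j_0)\in K_1$. Let $(x_1,y_1)\in K_2$ be NE of $(i_0,j_0)$, different from $(i_0,j_0)$, and not an admissible pixel with respect to $(i_0,j_0)$. Let $(i_1,j_1)\in K_1$ be an admissible pixel with respect to $(x_1,y_1)$, and assume that $(i_1,j_1)$ is NE of $(i_0,j_0)$ and that $i_1>i_0$. Put $$r=\delta(i_0,j_0,x_1,y_1)-\alpha(i_0,j_0)-\beta(x_1,y_1),\qquad a=\tfrac12\,\delta(i_0,j_0,i_1,j_1),$$ let $s$ be a real number with $0\le s<r$, put $$b=\delta(i_0,j_0,x_1,y_1)-\delta(i_1,j_1,x_1,y_1)-r+s,$$ and assume that $b>0$. Then, if $$\sqrt{(4a^2-b^2)/b^2}\ \ge\ \frac{j_1-j_0}{i_1-i_0},$$ we have $$LE[x_1,y_1]\cap K_2\subset L[(i_0,j_0),K_2,s].$$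
   Context: Dual variables are real numbers $\alpha(i,j)$, $(i,j)\in K_1$, and $\beta(x,y)$, $(x,y)\in K_2$. They are feasible if $\delta(i,j,x,y)-\alpha(i,j)-\beta(x,y)\ge 0$ for all $(i,j)\in K_1$, $(x,y)\in K_2$. A pair $\{(i,j),(x,y)\}$ with $(i,j)\in K_1$, $(x,y)\in K_2$ is an arc; it is admissible if $\alpha(i,j)+\beta(x,y)=\delta(i,j,x,y)$, and in that case $(x,y)$ is called an admissible pixel with respect to $(i,j)$ and vice versa. A point $(x',y')$ is NE (northeast) of a point $(x,y)$ if $x\le x'$ and $y\le y'$. $LE[i,j]=\{(x,y)\in\mathbb{R}^2:y=j,\ x\ge i\}$. Level set: for $(i,j)\in K_1$ and $t\ge 0$, $L[(i,j),K_2,t]=\{(x,y)\in K_2:\delta(i,j,x,y)-\alpha(i,j)-\beta(x,y)>t\}$. *)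

(* Defs.v *)
From mathcomp Require Import all_boot all_order all_algebra.
From mathcomp Require Import boolp classical_sets cardinality reals.

Set Implicit Arguments.
Unset Strict Implicit.
Unset Printing Implicit Defensive.

Import Order.TTheory GRing.Theory Num.Theory.

Local Open Scope classical_set_scope.
Local Open Scope ring_scope.

Section Defs.
Variable R : realType.

Definition plane : Type := (R * R)%type.

Definition eucl_dist (p q : plane) : R :=
  Num.sqrt ((p.1 - q.1) ^+ 2 + (p.2 - q.2) ^+ 2).

(* [is_NE q p]: q is northeast of p (weakly, so every point is NE of itself). *)
Definition is_NE (q p : plane) : Prop := p.1 <= q.1 /\ p.2 <= q.2.

Definition LE (p : plane) : set plane := [set q | q.2 = p.2 /\ p.1 <= q.1].

(* The dual variables are total functions on the plane, but only their values
   on K1 (for alpha) and on K2 (for beta) are ever constrained or used. *)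
Section Duals.
Variables (delta : plane -> plane -> R) (K1 K2 : set plane).
Variables (alpha beta : plane -> R).

Definition feasible : Prop :=
  forall p q, K1 p -> K2 q -> 0 <= delta p q - alpha p - beta q.

Definition arc (p q : plane) : Prop := K1 p /\ K2 q.

Definition admissible (p q : plane) : Prop :=
  arc p q /\ alpha p + beta q = delta p q.

Definition level_set (p : plane) (t : R) : set plane :=
  [set q | K2 q /\ t < delta p q - alpha p - beta q].

End Duals.
End Defs.

(* Main.v *)
(** With p = (i0, j0), p1 = (i1, j1) and q1 = (x1, y1), feasibility at p1 and
    admissibility of {p1, q1} reduce the claim to d(p, q) - d(p1, q) > b for q
    on the ray, while s < r says that the same holds at q1.  The set
    {q | d(p, q) - d(p1, q) > b} is the inside of a hyperbola branch; the slope
    condition says that the direction (1, 0) lies between its asymptotes, which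
    amounts to b <= i1 - i0.  Moving q to the right by t then adds
    2t(i1 - i0) to d(p, q)^2 - d(p1, q)^2 and at most 2bt to
    (b + d(p1, q))^2 - d(p1, q)^2. *)

Require Import Defs.
From mathcomp Require Import all_boot all_order all_algebra.
From mathcomp Require Import boolp classical_sets cardinality reals.
From mathcomp Require Import ring lra.

Import Order.TTheory GRing.Theory Num.Theory.

Local Open Scope classical_set_scope.
Local Open Scope ring_scope.

Section EuclideanDistance.
Context {R : realType}.
Implicit Types p q z : plane R.

Lemma eucl_dist_ge0 p q : 0 <= eucl_dist p q.
Proof. exact: sqrtr_ge0. Qed.

Lemma sqr_eucl_dist p q :
  eucl_dist p q ^+ 2 = (p.1 - q.1) ^+ 2 + (p.2 - q.2) ^+ 2.
Proof. by rewrite sqr_sqrtr // addr_ge0 ?sqr_ge0. Qed.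

Lemma eucl_dist_horizontal (x x' y : R) :
  x <= x' -> eucl_dist (x, y) (x', y) = x' - x.
Proof.
move=> lexx'; rewrite /eucl_dist /= subrr expr0n addr0 sqrtr_sqr distrC.
by rewrite ger0_norm // subr_ge0.
Qed.

(** Both sides are nonnegative, so squaring reduces this to the Cauchy-Schwarz inequality [CS]. *)
Lemma eucl_dist_triangle q p z :
  eucl_dist p z <= eucl_dist p q + eucl_dist q z.
Proof.
have Dge0 := addr_ge0 (eucl_dist_ge0 p q) (eucl_dist_ge0 q z).
rewrite -(ler_pXn2r (ltn0Sn 1)) ?nnegrE ?eucl_dist_ge0 // sqrrD !sqr_eucl_dist.
set u1 := p.1 - q.1; set u2 := p.2 - q.2.
set v1 := q.1 - z.1; set v2 := q.2 - z.2.
have CS : u1 * v1 + u2 * v2 <= eucl_dist p q * eucl_dist q z.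
  apply: le_trans (ler_norm _) _.
  rewrite -(ler_pXn2r (ltn0Sn 1)) ?nnegrE ?mulr_ge0 ?eucl_dist_ge0 //.
  rewrite real_normK ?num_real // exprMn !sqr_eucl_dist -/u1 -/u2 -/v1 -/v2.
  (* By Lagrange's identity this square is the gap between the two sides. *)
  have := sqr_ge0 (u1 * v2 - u2 * v1); nra.
have -> : p.1 - z.1 = u1 + v1 by rewrite /u1 /v1; ring.
have -> : p.2 - z.2 = u2 + v2 by rewrite /u2 /v2; ring.
by move: CS; lra.
Qed.

End EuclideanDistance.

(* For c = |u| the square root is the slope of the asymptotes of the hyperbola
   whose foci differ by u and whose distance difference is b. *)
Lemma le_of_slope_le_asymptote {R : rcfType} (u1 u2 b c : R) :
  0 < u1 -> 0 <= u2 -> 0 < b -> b <= c -> c ^+ 2 = u1 ^+ 2 + u2 ^+ 2 ->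
  u2 / u1 <= Num.sqrt ((c ^+ 2 - b ^+ 2) / b ^+ 2) -> b <= u1.
Proof.
move=> u1_gt0 u2_ge0 b_gt0 le_bc def_c.
have c2_gt0 : 0 < c ^+ 2 by rewrite exprn_gt0 // (lt_le_trans b_gt0).
have cb_ge0 : 0 <= (c ^+ 2 - b ^+ 2) / b ^+ 2.
  by rewrite divr_ge0 ?sqr_ge0 // subr_ge0 ler_pXn2r // nnegrE; lra.
rewrite -(ler_pXn2r (ltn0Sn 1)) ?nnegrE ?sqrtr_ge0 ?divr_ge0 ?(ltW u1_gt0) //.
rewrite sqr_sqrtr // expr_div_n ler_pdivrMr ?exprn_gt0 // mulrAC.
rewrite ler_pdivlMr ?exprn_gt0 // => le_slope.
(* Substituting [u2 ^+ 2 = c ^+ 2 - u1 ^+ 2] in the squared slope condition makes it factor this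
   way. *)
have : 0 <= c ^+ 2 * (u1 ^+ 2 - b ^+ 2).
  have -> : c ^+ 2 * (u1 ^+ 2 - b ^+ 2) =
      (c ^+ 2 - b ^+ 2) * u1 ^+ 2 - u2 ^+ 2 * b ^+ 2 by rewrite def_c; ring.
  by rewrite subr_ge0.
by rewrite pmulr_rge0 // subr_ge0 ler_pXn2r // nnegrE ltW.
Qed.

Lemma dist_diff_gt_horizontal {R : realType} (p p1 : plane R) (x x' y b : R) :
  0 <= b -> b <= p1.1 - p.1 -> x <= x' ->
  b < eucl_dist p (x, y) - eucl_dist p1 (x, y) ->
  b < eucl_dist p (x', y) - eucl_dist p1 (x', y).
Proof.
move=> b_ge0 le_b lexx' lt_b.
have := eucl_dist_triangle (x, y) p1 (x', y); rewrite eucl_dist_horizontal //.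
have := sqr_eucl_dist p (x, y); have := sqr_eucl_dist p1 (x, y).
have := sqr_eucl_dist p (x', y); have := sqr_eucl_dist p1 (x', y).
have := eucl_dist_ge0 p1 (x', y); have := eucl_dist_ge0 p (x', y).
have := eucl_dist_ge0 p1 (x, y); move: lt_b.
move: (eucl_dist p _) (eucl_dist p1 _) (eucl_dist p _) (eucl_dist p1 _).
move=> /= D0' D1' D0 D1 lt_b D1_ge0 D0'_ge0 D1'_ge0 D1'E D0'E D1E D0E tri.
rewrite ltrBrDr -(ltr_pXn2r (ltn0Sn 1)) ?nnegrE ?addr_ge0 //.
have lt_sqr : (b + D1) ^+ 2 < D0 ^+ 2.
  by rewrite ltr_pXn2r // ?nnegrE ?addr_ge0 //; lra.
(* This is [tri] scaled by [b]. Once the squares are expanded, the goal is linear in this bound,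
   [le_shift] and [lt_sqr]. *)
have le_mul : b * D1' <= b * (D1 + (x' - x)) by rewrite ler_wpM2l.
have le_shift : b * (x' - x) <= (p1.1 - p.1) * (x' - x).
  by rewrite ler_wpM2r ?subr_ge0.
rewrite sqrrD D1'E D0'E; rewrite sqrrD D1E D0E in lt_sqr.
lra.
Qed.

Theorem theorem5 (R : realType) (K1 K2 : set (plane R))
  (finK1 : finite_set K1) (finK2 : finite_set K2)
  (alpha beta : plane R -> R)
  (feas : feasible (@eucl_dist R) K1 K2 alpha beta)
  (adm1 : forall p, K1 p ->
     exists q, admissible (@eucl_dist R) K1 K2 alpha beta p q)
  (adm2 : forall q, K2 q ->
     exists p, admissible (@eucl_dist R) K1 K2 alpha beta p q)
  (i0 j0 : R) (K1ij0 : K1 (i0, j0))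
  (x1 y1 : R) (K2xy1 : K2 (x1, y1))
  (NExy1 : is_NE (x1, y1) (i0, j0))
  (neqxy1 : (x1, y1) <> (i0, j0))
  (nadm : ~ admissible (@eucl_dist R) K1 K2 alpha beta (i0, j0) (x1, y1))
  (i1 j1 : R) (K1ij1 : K1 (i1, j1))
  (admij1 : admissible (@eucl_dist R) K1 K2 alpha beta (i1, j1) (x1, y1))
  (NEij1 : is_NE (i1, j1) (i0, j0))
  (lti : i0 < i1)
  (r : R)
  (def_r : r = eucl_dist (i0, j0) (x1, y1) - alpha (i0, j0) - beta (x1, y1))
  (a : R) (def_a : a = 2^-1 * eucl_dist (i0, j0) (i1, j1))
  (s : R) (s_ge0 : 0 <= s) (s_ltr : s < r)
  (b : R)
  (def_b : b = eucl_dist (i0, j0) (x1, y1) - eucl_dist (i1, j1) (x1, y1) - r + s)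
  (b_gt0 : 0 < b)
  (slope : (j1 - j0) / (i1 - i0) <= Num.sqrt ((4 * a ^+ 2 - b ^+ 2) / b ^+ 2)) :
  LE (x1, y1) `&` K2 `<=`
    level_set (@eucl_dist R) K2 alpha beta (i0, j0) s.
Proof.
move=> [x y] [[/= -> le_x1x] K2q]; split=> //.
have [_ admE] := admij1; have [_ /= le_j0j1] := NEij1.
have def_c : 2 * a = eucl_dist (i0, j0) (i1, j1) by rewrite def_a mulVKf ?pnatr_eq0.
have lt_b : b < eucl_dist (i0, j0) (x1, y1) - eucl_dist (i1, j1) (x1, y1) by lra.
(* The foci are [2 * a] apart, which bounds any difference of distances to them; this keeps the
   radicand in [slope] nonnegative. *)
have le_b2a : b <= 2 * a.
  by have := eucl_dist_triangle (i1, j1) (i0, j0) (x1, y1); lra.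
have le_b : b <= i1 - i0.
  apply: (le_of_slope_le_asymptote _ (j1 - j0) _ (2 * a)) => //.
  - by rewrite subr_gt0.
  - by rewrite subr_ge0.
  - by rewrite def_c sqr_eucl_dist /=; ring.
  - by rewrite exprMn -natrX.
have := dist_diff_gt_horizontal (i0, j0) (i1, j1) x1 x y1 b
  (ltW b_gt0) le_b le_x1x lt_b.
(* By [def_r] and [admE], [b] equals [alpha (i0, j0) - alpha (i1, j1) + s], and feasibility gives
   [eucl_dist (i1, j1) (x, y) >= alpha (i1, j1) + beta (x, y)]. *)
by have := feas _ _ K1ij1 K2q; lra.
Qed.
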